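(* Let $f:[0,1]\to\mathbb{R}^d$ be the self-affine function described in the context, with ratios $\lambda_1,\dots,\lambda_m$ and $c_1,\dots,c_m$. (i) If $\lambda_i\geq c_i$ for each $i$, then $f$ is nowhere differentiable. (ii) If $\lambda_i<c_i$ for at least one $i$ but $\sum_{i=1}^m c_i\log(\lambda_i/c_i)\geq 0$, then $f$ is nondifferentiable (Lebesgue) almost everywhere but $f'(t)=0$ at uncountably many points $t$. (iii) If $\sum_{i=1}^m c_i\log(\lambda_i/c_i)<0$, then $f'(t)=0$ almost everywhere but $f$ is nondifferentiable at uncountably many points.
   Context: Setting. Fix integers $d\geq 1$ and $m\geq 2$, let $\mathbf{a}=(0,0,\dots,0)$ and $\mathbf{b}=(1,0,\dots,0)$ in $\mathbb{R}^d$, and fix $\boldsymbol\varepsilon=(\varepsilon_1,\dots,\varepsilon_m)\in\{0,1\}^m$ (the signature). Let $S_1,\dots,S_m$ be contractive similitudes of $\mathbb{R}^d$ with ratios $\lambda_i:=\mathrm{Lip}(S_i)\in[0,1)$ (if $m\geq 3$ one or more $S_i$ may be constant, so $\lambda_i=0$; if $m=2$ all $\lambda_i>0$), satisfying $S_1((1-\varepsilon_1)\mathbf{a}+\varepsilon_1\mathbf{b})=\mathbf{a}$, $S_m(\varepsilon_m\mathbf{a}+(1-\varepsilon_m)\mathbf{b})=\mathbf{b}$, and $S_{i-1}(\varepsilon_{i-1}\mathbf{a}+(1-\varepsilon_{i-1})\mathbf{b})=S_i((1-\varepsilon_i)\mathbf{a}+\varepsilon_i\mathbf{b})$ for $i=2,\dots,m$.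 Let $c_1,\dots,c_m>0$ with $\sum_{i=1}^m c_i=1$, put $\sigma_i:=\sum_{j=1}^{i-1}c_j+\varepsilon_ic_i$, $\phi_i(t):=(-1)^{\varepsilon_i}c_it+\sigma_i$, and $I_i:=\phi_i([0,1])$. Then $f:[0,1]\to\mathbb{R}^d$ is the unique continuous function with $f(t)=S_i(f(\phi_i^{-1}(t)))$ for $t\in I_i$, $i=1,\dots,m$. It is assumed throughout that $(\lambda_1,\dots,\lambda_m)\neq(c_1,\dots,c_m)$. Conventions: $f$ is differentiable at $t\in(0,1)$ if it has a well-defined finite derivative there; $\log 0:=-\infty$. *)

(* Defs.v *)
From HB Require Import structures.
From mathcomp Require Import all_boot all_order all_algebra.
From mathcomp Require Import all_classical all_reals all_analysis.
From mathcomp Require Import ring.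

Set Implicit Arguments.
Unset Strict Implicit.
Unset Printing Implicit Defensive.

Import Order.TTheory GRing.Theory Num.Theory.
Import numFieldNormedType.Exports.

Local Open Scope classical_set_scope.
Local Open Scope ring_scope.

(* The library norm on 'rV[R]_d is the sup norm; similitudes are Euclidean. *)
Definition enorm (R : realType) (d : nat) (v : 'rV[R]_d) : R :=
  Num.sqrt (\sum_(j < d) v 0 j ^+ 2).

(* The ratio 0 is allowed and gives the constant maps. *)
Definition contractive_similitude (R : realType) (d : nat)
    (S : 'rV[R]_d -> 'rV[R]_d) (lam : R) : Prop :=
  0 <= lam < 1 /\ forall x y, enorm (S x - S y) = lam * enorm (x - y).

Definition pt_a (R : realType) (d : nat) : 'rV[R]_d := 0.

Definition pt_b (R : realType) (d : nat) : 'rV[R]_d :=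
  \row_(j < d) ((j : nat) == 0%N)%:R.

(* [S_i] maps the segment from [a] to [b] onto the segment from
   [S_i (start_pt (eps i))] to [S_i (end_pt (eps i))], traversed in this
   order. *)
Definition start_pt (R : realType) (d : nat) (e : bool) : 'rV[R]_d :=
  (1 - e%:R) *: pt_a R d + e%:R *: pt_b R d.

Definition end_pt (R : realType) (d : nat) (e : bool) : 'rV[R]_d :=
  e%:R *: pt_a R d + (1 - e%:R) *: pt_b R d.

Section Phi.
Context (R : realType) (m : nat) (eps : 'I_m -> bool) (c : 'I_m -> R).

Definition sigma (i : 'I_m) : R :=
  \sum_(j < m | (j < i)%N) c j + (eps i)%:R * c i.

Definition phi (i : 'I_m) (t : R) : R := (-1) ^+ eps i * c i * t + sigma i.

Definition phi_inv (i : 'I_m) (t : R) : R :=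
  (t - sigma i) / ((-1) ^+ eps i * c i).

Lemma phiK (i : 'I_m) : c i != 0 -> cancel (phi i) (phi_inv i).
Proof.
move=> ci0 t; rewrite /phi_inv /phi addrK mulrC mulKf //.
by rewrite mulf_neq0 // signr_eq0.
Qed.

Lemma phi_invK (i : 'I_m) : c i != 0 -> cancel (phi_inv i) (phi i).
Proof.
move=> ci0 t; rewrite /phi_inv /phi mulrC divfK ?subrK //.
by rewrite mulf_neq0 // signr_eq0.
Qed.

Definition piece (i : 'I_m) : set R := phi i @` `[0, 1].

End Phi.

Section Differentiability.
Context (R : realType) (d : nat) (f : R -> 'rV[R]_d).

Definition differentiable_at (t : R) : Prop := derivable f t 1.

Definition zero_derivative_at (t : R) : Prop := is_derive t 1 f 0.

End Differentiability.

(* [lne] is the extended logarithm with [lne 0 = -oo]. *)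
Definition mean_log_ratio (R : realType) (m : nat) (lam c : 'I_m -> R) :
    \bar R :=
  (\sum_(i < m) (c i)%:E * lne (lam i / c i)%:E)%E.

(* Main.v *)
(* The map [f] carries the cylinder interval of a digit word [w], of length
   [c_w], to a copy of the curve scaled by [lam_w]. If [f] is differentiable at
   [t], its slopes over all subintervals comparable to the cylinders around [t]
   converge to [f'(t)]; comparing a cylinder with its subcylinders forces
   [lam = c] unless [f'(t) = 0], and then [lam_w / c_w] tends to 0 along the
   digits of [t]. This gives (i), and the uncountable set in (iii), since a
   continuous function with zero derivative off a countable set is constant.
   Conversely [f'(t) = 0] as soon as [lam_w / c_w] is negligible compared with
   the relative distance of [t] to the ends of its cylinders. When the mean
   logarithmic ratio is negative, a Chernoff bound and Borel-Cantelli give this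
   for almost every [t]; in (ii) it is arranged on a Cantor set. Finally, a
   random walk with bounded steps and nonnegative mean a.s. does not tend to
   [-oo] (optional stopping), hence the almost everywhere statement in (ii). *)

Require Import Defs.
From HB Require Import structures.
From mathcomp Require Import all_boot all_order all_algebra.
From mathcomp Require Import all_classical all_reals all_analysis.
From mathcomp Require Import ring lra.

Import Order.TTheory GRing.Theory Num.Theory.
Import numFieldNormedType.Exports.

Local Open Scope classical_set_scope.
Local Open Scope ring_scope.

Set Implicit Arguments.
Unset Strict Implicit.
Unset Printing Implicit Defensive.

(** * Comparison of the Euclidean norm with the sup norm *)

Section EuclideanNorm.
Context (R : realType) (d : nat).
Implicit Types u v : 'rV[R]_d.

Lemma enorm_ge0 v : 0 <= enorm v.
Proof. exact: sqrtr_ge0. Qed.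

Lemma enormZ (a : R) v : enorm (a *: v) = `|a| * enorm v.
Proof.
rewrite /enorm -sqrtr_sqr -sqrtrM ?sqr_ge0// big_distrr /=; congr Num.sqrt.
by apply: eq_bigr => j _; rewrite mxE exprMn.
Qed.

Lemma enorm_eq0 v : enorm v = 0 -> v = 0.
Proof.
move/eqP; rewrite sqrtr_eq0 => sum_le0; apply/rowP => j; rewrite mxE.
have : \sum_(k < d) v 0 k ^+ 2 == 0.
  by rewrite eq_le sum_le0 sumr_ge0// => k _; rewrite sqr_ge0.
by rewrite psumr_eq0 => [/allP/(_ j (mem_index_enum _))|k _];
  rewrite ?sqr_ge0//= sqrf_eq0 => /eqP.
Qed.

Lemma coord_le_norm v j : `|v 0 j| <= `|v|.
Proof.
rewrite {2}/Num.norm /= mx_normrE.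
by apply/bigmax_geP; right; exists (0, j).
Qed.

Lemma norm_le_enorm v : `|v| <= enorm v.
Proof.
rewrite {1}/Num.norm /= mx_normrE; apply/bigmax_leP; split=> [|[i j] _ /=].
  exact: enorm_ge0.
rewrite ord1 -sqrtr_sqr ler_wsqrtr// (bigD1 j)//= lerDl sumr_ge0// => k _.
by rewrite sqr_ge0.
Qed.

Lemma enorm_le_norm v : enorm v <= Num.sqrt d%:R * `|v|.
Proof.
rewrite -[X in _ * X]ger0_norm// -sqrtr_sqr -sqrtrM ?ler0n// ler_wsqrtr//.
rewrite -[d in d%:R]card_ord -sumr_const big_distrl /=; apply: ler_sum => j _.
rewrite mul1r -(real_normK (num_real (v 0 j))) lerXn2r ?nnegrE//.
exact: coord_le_norm.
Qed.

Lemma enorm_continuous : continuous (@enorm R d).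
Proof.
have sumsq r : continuous (fun v : 'rV[R]_d => \sum_(j <- r) v 0 j ^+ 2 : R).
  elim: r => [|j r IH] v.
    rewrite (_ : (fun _ => _) = cst 0); first exact: cst_continuous.
    by apply/funext => w; rewrite big_nil.
  rewrite (_ : (fun _ => _) = (fun w : 'rV[R]_d => w 0 j * w 0 j) \+
      (fun w : 'rV[R]_d => \sum_(j <- r) w 0 j ^+ 2)).
    apply: continuousD; last exact: IH.
    by apply: continuousM; exact: coord_continuous.
  by apply/funext => w; rewrite big_cons expr2.
by move=> v; apply: (continuous_comp (sumsq _ v)); exact: sqrt_continuous.
Qed.

End EuclideanNorm.

(** * Derivatives and slopes of chords *)

Section DifferenceQuotients.
Context (R : realType) (V : normedModType R) (f : R -> V).

Lemma norm_quotient (h : R) (v w : V) : h != 0 ->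
  `|v - h^-1 *: w| = `|w - h *: v| / `|h|.
Proof.
move=> h0; rewrite distrC -normfV mulrC -normrZ scalerBr scalerA.
by rewrite mulVf// scale1r.
Qed.

(** Division-free form of differentiability, in which [x = t] needs no exclusion. *)
Definition has_derivative (t : R) (v : V) := forall e, 0 < e ->
  exists2 dl, 0 < dl & forall x, `|x - t| < dl ->
    `|f x - f t - (x - t) *: v| <= e * `|x - t|.

Lemma derivable_has_derivative t :
  derivable f t 1 -> exists v, has_derivative t v.
Proof.
move=> /cvg_ex[v /cvgrPdist_le fv]; exists v => e e0.
have := fv e e0; rewrite near_withinE => /nbhs_ballP[dl /= dl0 H].
exists dl => // x xt.
have [->|xNt] := eqVneq x t.
  by rewrite !subrr scale0r subrr !normr0 mulr0.
have h0 : x - t != 0 by rewrite subr_eq0.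
have := H (x - t); rewrite /ball /= sub0r normrN => /(_ xt h0).
by rewrite /shift /= scaler1 subrK norm_quotient// ler_pdivrMr ?normr_gt0.
Qed.

Lemma has_derivative_is_derive t v : has_derivative t v -> is_derive t 1 f v.
Proof.
move=> fv.
have fv' : h^-1 *: ((f \o shift t) (h *: (1 : R)) - f t) @[h --> 0^'] --> v.
  apply/cvgrPdist_le => e e0; have [dl dl0 H] := fv e e0.
  rewrite near_withinE; apply/nbhs_ballP; exists dl => //= h.
  rewrite /ball /= sub0r normrN => hdl h0.
  have := H (h + t); rewrite addrK => /(_ hdl).
  by rewrite /shift /= scaler1 norm_quotient// ler_pdivrMr ?normr_gt0.
apply: DeriveDef; first by apply/cvg_ex; exists v.
exact: cvg_lim fv'.
Qed.

(** The chords need not contain [t]: the error at each endpoint is small relative to its distance to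
    [t], hence relative to the length of the chord by the bounds with [K]. *)
Lemma slope_cvg t v (x y : nat -> R) K : has_derivative t v ->
    x @ \oo --> t -> y @ \oo --> t -> (forall n, x n != y n) ->
    (forall n, `|x n - t| <= K * `|x n - y n|) ->
    (forall n, `|y n - t| <= K * `|x n - y n|) ->
  (x n - y n)^-1 *: (f (x n) - f (y n)) @[n --> \oo] --> v.
Proof.
move=> fv xt yt xy xK yK.
have K0 : 0 <= K.
  have := le_trans (normr_ge0 _) (xK 0%N).
  by rewrite pmulr_lge0// normr_gt0 subr_eq0.
apply/cvgrPdist_le => e e0.
(* Each endpoint may use half of [e]; [K + 1] is visibly positive. *)
have e1 : 0 < e / (2 * (K + 1)) by rewrite divr_gt0// mulr_gt0// ltr_wpDl.
have [dl dl0 H] := fv _ e1.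
move/cvgrPdist_lt : xt => /(_ _ dl0) xt.
move/cvgrPdist_lt : yt => /(_ _ dl0) yt.
near=> n.
have n0 : x n - y n != 0 by rewrite subr_eq0.
rewrite norm_quotient// distrC ler_pdivrMr ?normr_gt0//.
have Hx := H (x n); have Hy := H (y n).
have -> : (x n - y n) *: v - (f (x n) - f (y n)) =
   (f (y n) - f t - (y n - t) *: v) - (f (x n) - f t - (x n - t) *: v).
  rewrite [X in _ = _ + X]opprB [RHS]addrC [in RHS](addrC (f (y n) - f t)).
  rewrite [RHS]addrACA.
  by rewrite -scalerBl !opprB subrKA [in RHS](addrC _ (f (y n) - f t)) subrKA.
apply: (le_trans (ler_normB _ _)).
have -> : e * `|x n - y n| = e / (2 * (K + 1)) * ((K + 1) * `|x n - y n|) +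
    e / (2 * (K + 1)) * ((K + 1) * `|x n - y n|).
  by field; rewrite gt_eqF// ltr_wpDl.
apply: lerD.
  apply: le_trans (Hy _) _; first by rewrite distrC; near: n.
  rewrite (ler_wpM2l (ltW e1))// (le_trans (yK n))// ler_wpM2r// lerDl.
  exact: ler01.
apply: le_trans (Hx _) _; first by rewrite distrC; near: n.
by rewrite (ler_wpM2l (ltW e1))// (le_trans (xK n))// ler_wpM2r// lerDl.
Unshelve. all: by end_near. Qed.

End DifferenceQuotients.

Lemma prod_cvg0 (R : realType) (a : nat -> R) (q : R) :
  (forall k, `|a k| <= q) -> q < 1 ->
  \prod_(k < n) a k @[n --> \oo] --> (0 : R).
Proof.
move=> aq q1; have q0 : 0 <= q := le_trans (normr_ge0 _) (aq 0%N).
have qn : q ^+ n @[n --> \oo] --> (0 : R) by apply: cvg_expr; rewrite ger0_norm.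
apply/cvgrPdist_le => e e0; move/cvgrPdist_le : qn => /(_ _ e0).
apply: filterS => n; rewrite !sub0r !normrN normr_prod ger0_norm ?exprn_ge0//.
apply: le_trans; rewrite -[n in X in _ <= X]card_ord -prodr_const.
by apply: ler_prod => k _; rewrite normr_ge0 aq.
Qed.

(** * Compositions of affine maps along which [f] scales distances *)

Section Scaling.
Context (R : realType) (d : nat) (f : R -> 'rV[R]_d).

(** The sign of [a] is free, so that orientation-reversing pieces are included. *)
Definition scales (a b L : R) := [/\ a != 0, 0 <= L,
  forall x, 0 <= x <= 1 -> 0 <= a * x + b <= 1 &
  forall x y, 0 <= x <= 1 -> 0 <= y <= 1 ->
    enorm (f (a * x + b) - f (a * y + b)) = L * enorm (f x - f y)].

Lemma scales_id : scales 1 0 1.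
Proof.
by split=> [||x|x y _ _]; rewrite ?oner_eq0 ?mul1r ?addr0 ?ler01.
Qed.

Lemma scales_comp a b L a' b' L' : scales a b L -> scales a' b' L' ->
  scales (a * a') (a * b' + b) (L * L').
Proof.
move=> [a0 L0 ab abL] [a'0 L'0 ab' abL'].
have E x : a * a' * x + (a * b' + b) = a * (a' * x + b') + b by ring.
split=> [||x x01|x y x01 y01]; [by rewrite mulf_neq0|exact: mulr_ge0| |].
  by rewrite E ab// ab'.
by rewrite !E abL ?ab'// abL'// mulrA.
Qed.

(* [x 0] is the image of [x n] under the composition of the first [n] maps
   [z |-> a k * z + b k]. *)
Definition code (a b L x : nat -> R) := forall n,
  [/\ 0 <= x n <= 1, x n = a n * x n.+1 + b n & scales (a n) (b n) (L n)].

Context (a b L x : nat -> R) (abLx : code a b L x).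

(** The composition sends [x n] to [x 0], which determines its constant term without a separate
    recursion. *)
Lemma code_scales n : scales (\prod_(k < n) a k)
  (x 0%N - \prod_(k < n) a k * x n) (\prod_(k < n) L k).
Proof.
elim: n => [|n IH]; first by rewrite !big_ord0 mul1r subrr; exact: scales_id.
have [_ xn /(scales_comp IH)] := abLx n; rewrite !big_ord_recr /= xn.
set A := \prod_(k < n) a k; congr (scales _ _ _); ring.
Qed.

Lemma code_dist p n : \prod_(k < n) a k * p + (x 0%N - \prod_(k < n) a k * x n)
    - x 0%N = \prod_(k < n) a k * (p - x n).
Proof. ring. Qed.

(** The images of [p] and [q] under the first [n] maps are within [|A n|] of [x 0] and
    [|A n| * |p - q|] apart, so [slope_cvg] applies with [K = 1 / |p - q|]. *)
Lemma code_slope_cvg v p q : \prod_(k < n) a k @[n --> \oo] --> (0 : R) ->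
    has_derivative f (x 0%N) v -> 0 <= p <= 1 -> 0 <= q <= 1 -> p != q ->
  \prod_(k < n) (L k / `|a k|) * (enorm (f p - f q) / `|p - q|) @[n --> \oo]
    --> enorm v.
Proof.
move=> A0 fv p01 q01 pq; have pq0 : 0 < `|p - q| by rewrite normr_gt0 subr_eq0.
pose A n := \prod_(k < n) a k.
have An0 n : A n != 0 by have [] := code_scales n.
pose z s n := A n * s + (x 0%N - A n * x n).
have zd n : z p n - z q n = A n * (p - q) by rewrite /z; ring.
have zx s n : 0 <= s <= 1 -> `|z s n - x 0%N| <= `|A n|.
  move=> s01; rewrite code_dist normrM ler_piMr//.
  by have [+ _ _] := abLx n; rewrite ler_norml; lra.
have zlim s : 0 <= s <= 1 -> z s @ \oo --> x 0%N.
  move=> s01; apply/cvgrPdist_le => e e0.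
  move/cvgrPdist_le : A0 => /(_ _ e0); apply: filterS => n.
  by rewrite sub0r normrN distrC; exact/le_trans/zx.
have zK s n : 0 <= s <= 1 -> `|z s n - x 0%N| <= `|p - q|^-1 * `|z p n - z q n|.
  by move=> s01; rewrite zd normrM mulrCA mulVf ?gt_eqF// mulr1 zx.
have zpq n : z p n != z q n by rewrite -subr_eq0 zd mulf_neq0// subr_eq0.
have := slope_cvg fv (zlim p p01) (zlim q q01) zpq (zK p ^~ p01) (zK q ^~ q01).
move=> /(continuous_cvg _ (@enorm_continuous R d v)); apply: cvg_trans.
apply: near_eq_cvg; near=> n.
have [_ _ _ AL] := code_scales n.
transitivity (`|(z p n - z q n)^-1| * enorm (f (z p n) - f (z q n))).
  exact: enormZ.
rewrite zd /z /A AL// prodf_div normfV normrM normr_prod.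
by rewrite invfM; ring.
Unshelve. all: by end_near. Qed.

(* [g n] bounds from below the distance of [x n] to the ends of the image of the
   [n]-th map. A point near [x 0] leaves the nested images at some order [n],
   hence is at distance at least [|A n| * g n] from [x 0], where [A n] is the
   slope of the composition of the first [n] maps. *)
Lemma code_zero_derivative (D : R) (e g : nat -> R) N :
    \prod_(k < n) a k @[n --> \oo] --> (0 : R) ->
    (forall y z, 0 <= y <= 1 -> 0 <= z <= 1 -> enorm (f y - f z) <= D) ->
    (forall n, (N <= n)%N ->
      [/\ 0 < g n, g n <= `|x n - b n| & g n <= `|x n - (a n + b n)|]) ->
    (forall n, (N <= n)%N ->
      D * \prod_(k < n) L k <= e n * (`|\prod_(k < n) a k| * g n)) ->
    e @ \oo --> (0 : R) ->
  has_derivative f (x 0%N) 0.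
Proof.
move=> A0 fD gN eN e0 eps eps0; pose A n := \prod_(k < n) a k.
have An0 n : A n != 0 by have [] := code_scales n.
have x01 n : (N < n)%N -> 0 < x n < 1.
  case: n => // n; rewrite ltnS => /gN[g0 gb gab].
  have [_ xn _] := abLx n; have [+ _ _] := abLx n.+1.
  have : x n.+1 != 0.
    apply/eqP => x0; move: gb.
    by rewrite xn x0 mulr0 add0r subrr normr0 leNgt g0.
  have : x n.+1 != 1.
    by apply/eqP => x1; move: gab; rewrite xn x1 mulr1 subrr normr0 leNgt g0.
  by move=> x1 x0 /andP[xge0 xle1]; rewrite !lt_neqAle eq_sym x0 x1 xge0.
have [n1 [n1N n1e]] : exists n1, (N < n1)%N /\
    forall n, (n1 <= n)%N -> e n <= eps.
  move/cvgrPdist_le : e0 => /(_ _ eps0) [n2 _ H].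
  exists (maxn N.+1 n2); rewrite leq_max leqnn; split=> // n.
  rewrite geq_max => /andP[_ /H]; rewrite sub0r normrN.
  by apply: le_trans; exact: ler_norm.
have x1 := x01 _ n1N.
(* Within this radius [y] stays in the image of order [n1], so it can leave the nested images only
   at an order where the bounds are available. *)
exists (`|A n1| * Num.min (x n1) (1 - x n1)).
  by rewrite mulr_gt0 ?normr_gt0// lt_min; lra.
move=> y yt; rewrite scaler0 subr0.
have [->|yNt] := eqVneq y (x 0%N); first by rewrite !subrr !normr0 mulr0.
pose w n := x n + (y - x 0%N) / A n.
have yw n : y = A n * w n + (x 0%N - A n * x n).
  by rewrite /w; field.
have wS n : w n - x n = a n * (w n.+1 - x n.+1).
  have [_ _ [an0 _ _ _]] := abLx n.
  have AS : A n.+1 = A n * a n by rewrite /A big_ord_recr.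
  by rewrite /w AS; field; rewrite an0 An0.
have exn : exists n, (n1 <= n)%N && ~~ (0 <= w n <= 1).
  have yt0 : 0 < `|y - x 0%N| by rewrite normr_gt0 subr_eq0.
  move/cvgrPdist_lt : A0 => /(_ _ yt0) [n2 _ H].
  exists (maxn n1 n2); rewrite leq_maxl /=; apply/negP => w01.
  have := H (maxn n1 n2); rewrite /= leq_maxr => /(_ isT).
  rewrite sub0r normrN -/(A _) {1}(yw (maxn n1 n2)) code_dist -/(A _) normrM.
  rewrite ltNge ler_piMr//.
  by have [+ _ _] := abLx (maxn n1 n2); rewrite ler_norml; lra.
case: (ex_minnP exn) => n /andP[n1n wn] nmin.
have w1 : 0 <= w n1 <= 1.
  move: yt; rewrite {1}(yw n1) code_dist -/(A _) normrM ltr_pM2l ?normr_gt0//.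
  by rewrite lt_min !ltr_norml; lra.
case: n => [|n] in n1n wn nmin *.
  by move: n1n; rewrite leqn0 => /eqP n10; rewrite -n10 w1 in wn.
have {}n1n : (n1 <= n)%N.
  move: n1n; rewrite leq_eqVlt => /orP[/eqP E|//].
  by rewrite -E w1 in wn.
have {nmin} w01 : 0 <= w n <= 1.
  by apply: contraT => H; have := nmin n; rewrite n1n H ltnn => /(_ isT).
have Nn : (N <= n)%N by rewrite (leq_trans (ltnW n1N)).
have [g0 gb gab] := gN n Nn.
have [xn01 xn [an0 _ _ _]] := abLx n.
have [xS01 _ _] := abLx n.+1.
(* [w n.+1] has left the unit interval, so an end of the image of the [n]-th map separates [w n]
   from [x n]. *)
have gw : g n <= `|w n - x n|.
  rewrite wS normrM; have an : 0 < `|a n| by rewrite normr_gt0.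
  have [w0|w0] := ltP (w n.+1) 0.
    apply: (le_trans gb); rewrite {1}xn addrK normrM ler_pM2l//.
    by rewrite ger0_norm ?ler0_norm; lra.
  apply: (le_trans gab).
  have -> : x n - (a n + b n) = a n * (x n.+1 - 1) by rewrite xn; ring.
  rewrite normrM ler_pM2l//; move: wn; rewrite w0 /= -ltNge => w1'.
  by rewrite ler0_norm ?ger0_norm; lra.
have [_ L0 _ AL] := code_scales n.
apply: (le_trans (norm_le_enorm _)).
have -> : f y - f (x 0%N) = f (A n * w n + (x 0%N - A n * x n)) -
    f (A n * x n + (x 0%N - A n * x n)) by rewrite -yw subrKC.
rewrite AL// (le_trans (ler_wpM2l L0 (fD _ _ w01 xn01)))// mulrC.
apply: (le_trans (eN n Nn)).
rewrite [y](yw n) code_dist normrM.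
apply: (@le_trans _ _ (eps * (`|A n| * g n))).
  by rewrite ler_wpM2r ?n1e// mulr_ge0// ltW.
by rewrite (ler_wpM2l (ltW eps0))// ler_wpM2l.
Qed.

End Scaling.

(** * Functions with zero derivative off a countable set *)

Lemma itv_uncountable (R : realType) (a b : R) :
  a < b -> ~ countable `]a, b[%classic.
Proof.
move=> ab /countable_lebesgue_measure0; rewrite lebesgue_measure_itv /=.
by rewrite lte_fin ab => /eqP; rewrite -EFinB eqe subr_eq0 gt_eqF.
Qed.

Lemma within_continuous_dist (R : realType) (V : normedModType R) (g : R -> V)
    (a b s : R) :
  {within `[a, b], continuous g} -> a <= s <= b -> forall e, 0 < e ->
  exists2 dl, 0 < dl & forall x, a <= x <= b -> `|x - s| < dl ->
    `|g x - g s| < e.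
Proof.
move=> /subspace_continuousP gc sab e e0.
have /cvgrPdist_lt/(_ _ e0) : g @ within `[a, b] (nbhs s) --> g s.
  by apply: gc; rewrite /= in_itv.
rewrite near_withinE => /nbhs_ballP[dl /= dl0 H]; exists dl => // x xab xs.
by rewrite distrC; apply: H; rewrite /= ?in_itv//= /ball /= distrC.
Qed.

Lemma within_continuous_coord (R : realType) (d : nat) (A : set R)
    (f : R -> 'rV[R]_d) (j : 'I_d) :
  {within A, continuous f} -> {within A, continuous (fun t => f t 0 j)}.
Proof.
move=> /subspace_continuousP fc; apply/subspace_continuousP => x Ax.
apply: (@cvg_comp _ _ _ f (fun v : 'rV[R]_d => v 0 j) _ _ _ (fc x Ax)).
exact: coord_continuous.
Qed.

Lemma zero_derivative_nonincreasing (R : realType) (g : R -> R) (a b : R)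
    (C : set R) :
  a < b -> {within `[a, b], continuous g} -> countable C ->
  (forall t, a < t < b -> ~ C t -> has_derivative g t 0) -> g b <= g a.
Proof.
move=> ab gc cC gC; rewrite leNgt; apply/negP => gab.
(* Half the mean slope of [g], so that [h] still satisfies [h a < h b]. *)
pose eps := (g b - g a) / (2 * (b - a)).
have eps0 : 0 < eps by rewrite divr_gt0 ?mulr_gt0 ?subr_gt0.
pose h t := g t - eps * (t - a).
have ha : h a = g a by rewrite /h subrr mulr0 subr0.
have hb : h b = g b - (g b - g a) / 2.
  by rewrite /h /eps; field; rewrite subr_eq0 gt_eqF.
have hab : h a < h b by rewrite ha hb; lra.
have hc : {within `[a, b], continuous h}.
  move=> x; apply: cvgB; first exact: gc.
  move: x; apply: continuous_subspaceT => x.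
  by apply: cvgM; [exact: cvg_cst|apply: cvgB; [exact: cvg_id|exact: cvg_cst]].
(* The last point where [h] takes the value [y] avoids [C], but there [h] has
   the negative derivative [- eps]. *)
have [y [yab yC]] : exists y, h a < y < h b /\ ~ (h @` C) y.
  apply: contrapT => H; apply: (itv_uncountable hab).
  apply: (@sub_countable _ _ _ (h @` C)); last first.
    exact: sub_countable (card_image_le h C) cC.
  apply: subset_card_le => y; rewrite /= in_itv/= => yab.
  by apply: contrapT => yC; apply: H; exists y.
pose E := [set t | a <= t <= b /\ h t <= y].
have Ea : E a by rewrite /E /=; lra.
have Eub : has_sup E by split; [exists a|exists b => t [] /andP[]].
pose s := sup E.
have as_ : a <= s by apply: ub_le_sup Ea; case: Eub.
have sb : s <= b by apply: ge_sup; [exists a|move=> t [/andP[]]].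
have sab : a <= s <= b by rewrite as_.
have hs_le : h s <= y.
  rewrite leNgt; apply/negP => ys; have ys0 : 0 < h s - y by rewrite subr_gt0.
  have [dl dl0 H] := within_continuous_dist hc sab ys0.
  have [t Et st] := sup_adherent dl0 Eub.
  have ts : t <= s by apply: ub_le_sup => //; case: Eub.
  have [tab ty] := Et.
  have := H t tab; rewrite ltr_norml ltr_norml -/s in st * => /(_ _).
  by move=> /(_ ltac:(lra)); lra.
have slb : s < b.
  by rewrite lt_neqAle sb andbT; apply/eqP => E1; move: hs_le; rewrite E1; lra.
have hs_ge : y <= h s.
  rewrite leNgt; apply/negP => ys; have ys0 : 0 < y - h s by rewrite subr_gt0.
  have [dl dl0 H] := within_continuous_dist hc sab ys0.
  pose t := s + Num.min (dl / 2) (b - s).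
  have st : s < t by rewrite /t ltrDl lt_min divr_gt0//= subr_gt0.
  have tdl : t < s + dl by rewrite /t ltrD2l gt_min; apply/orP; left; lra.
  have tb : t <= b by rewrite /t -lerBrDl ge_min lexx orbT.
  have tab : a <= t <= b by lra.
  have := H t tab; rewrite !ltr_norml => /(_ ltac:(lra)) ht.
  have Et : E t by split=> //; lra.
  by have : t <= s by [apply: ub_le_sup => //; case: Eub]; lra.
have hsy : h s = y by lra.
have sa : a < s.
  by rewrite lt_neqAle as_ andbT; apply/eqP => E1; rewrite -E1 in hsy; lra.
have sC : ~ C s by move=> Cs; apply: yC; exists s.
have sab' : a < s < b by rewrite sa.
(* Just to the right of [s], [h] exceeds its value at [s], so [g] grows there at a rate above [eps];
   the zero derivative of [g] at [s] allows at most [eps / 2]. *)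
have eps2 : 0 < eps / 2 by rewrite divr_gt0.
have [dl dl0 H] := gC s sab' sC _ eps2.
pose t := s + Num.min (dl / 2) (b - s).
have st : s < t by rewrite /t ltrDl lt_min divr_gt0//= subr_gt0.
have tdl : t < s + dl by rewrite /t ltrD2l gt_min; apply/orP; left; lra.
have tb : t <= b by rewrite /t -lerBrDl ge_min lexx orbT.
have ht : y < h t.
  rewrite ltNge; apply/negP => ht; have : t <= s; last by lra.
  by apply: ub_le_sup; [case: Eub|split=> //; lra].
have ts0 : 0 < t - s by rewrite subr_gt0.
have := H t; rewrite (gtr0_norm ts0) scaler0 subr0 => /(_ ltac:(lra)).
rewrite ler_norml => /andP[_ gts]; move: ht; rewrite -hsy /h.
have : 0 < eps * (t - s) by rewrite mulr_gt0.
by move: gts; rewrite !mulrBr; lra.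
Qed.

(** * Nested intervals and uncountability by diagonalization *)

Lemma nested_balls (R : realType) (c r : nat -> R) :
  (forall n, 0 <= r n) ->
  (forall n p, `|p - c n.+1| <= r n.+1 -> `|p - c n| <= r n) ->
  exists t, forall n, `|t - c n| <= r n.
Proof.
move=> r0 sub.
have subM n m p : `|p - c (n + m)%N| <= r (n + m)%N -> `|p - c n| <= r n.
  by elim: m => [|m IH]; rewrite ?addn0// addnS => /sub.
have lohi n m : c n - r n <= c m + r m.
  have H k l : (k <= l)%N -> `|c l - c k| <= r k.
    by move=> /subnKC E; apply: (@subM k (l - k)%N); rewrite E subrr normr0.
  have : `|c (n + m)%N - c n| <= r n by rewrite H// leq_addr.
  have : `|c (n + m)%N - c m| <= r m by rewrite H// leq_addl.
  by rewrite !ler_norml; lra.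
pose E := range (fun n => c n - r n).
have ubE m : ubound E (c m + r m) by move=> _ [n _ <-]; exact: lohi.
have supE : has_sup E.
  by split; [exists (c 0%N - r 0%N); exists 0%N|exists (c 0%N + r 0%N)].
exists (sup E) => n.
have : c n - r n <= sup E by apply: ub_le_sup; [case: supE|exists n].
have : sup E <= c n + r n by apply: ge_sup; case: supE.
by rewrite ler_norml; lra.
Qed.

(** Describing the image of the unit interval as a ball avoids a case distinction on the sign of
    [A]. *)
Lemma affine_image (R : realType) (A B p : R) : A != 0 ->
  `|p - (A / 2 + B)| <= `|A| / 2 <-> 0 <= (p - B) / A <= 1.
Proof.
move=> A0; have -> : p - (A / 2 + B) = A * ((p - B) / A - 1 / 2) by field.
rewrite normrM ler_pM2l ?normr_gt0// ler_norml.
by split=> /andP[? ?]; lra.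
Qed.

(* Given an injection [idx] of [P] into [nat], the [n]-th letter is chosen such
   that the image of the first [n.+1] maps misses the point of index [n]. *)
Lemma uncountable_codes (R : realType) (a b : bool -> R) (P : set R) :
  (forall i, a i != 0) ->
  (forall i y, 0 <= y <= 1 -> 0 <= a i * y + b i <= 1) ->
  (forall y z, 0 <= y <= 1 -> 0 <= z <= 1 ->
    a true * y + b true != a false * z + b false) ->
  (forall (w : nat -> bool) (x : nat -> R), (forall n, 0 <= x n <= 1) ->
    (forall n, x n = a (w n) * x n.+1 + b (w n)) -> P (x 0%N)) ->
  ~ countable P.
Proof.
move=> a0 ab01 disj PP /countable_injP[idx idx_inj].
pose child (s : R * R) i := (s.1 * a i, s.1 * b i + s.2).
pose coor (s : R * R) p := (p - s.2) / s.1.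
pose bit n s := ~~ `[< exists p, [/\ P p, idx p = n &
   0 <= coor (child s true) p <= 1] >].
pose fix st n := if n is n'.+1 then child (st n') (bit n' (st n')) else (1, 0).
pose w n := bit n (st n).
have stS n : st n.+1 = child (st n) (w n) by [].
have st0 n : (st n).1 != 0.
  by elim: n => [|n IH]; rewrite ?oner_eq0// stS mulf_neq0.
have coorS s i p : s.1 != 0 -> coor s p = a i * coor (child s i) p + b i.
  by move=> s0; rewrite /coor /=; field; rewrite s0 a0.
have [t tst] : exists t, forall n,
    `|t - ((st n).1 / 2 + (st n).2)| <= `|(st n).1| / 2.
  apply: nested_balls => [n|n p]; first by rewrite divr_ge0.
  move=> /(affine_image _ _ (st0 _)) H; apply/affine_image => //.
  by rewrite -/(coor (st n) p) (coorS _ (w n))// ab01.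
pose x n := coor (st n) t.
have x01 n : 0 <= x n <= 1 by apply/affine_image.
have xS n : x n = a (w n) * x n.+1 + b (w n) by rewrite /x (coorS _ (w n)).
have Pt : P t.
  have <- : x 0%N = t by rewrite /x /coor /= subr0 divr1.
  exact: PP x01 xS.
(* At stage [idx t], the letter [true] would contradict its own choice. The letter [false] was
   chosen because the point of that index, which is [t] by injectivity, lies in the [true] image,
   disjoint from the [false] one. *)
have := x01 (idx t).+1; have := xS (idx t).
rewrite /x stS; case wt: (w (idx t)) => xt.
  by move=> H; move: wt; rewrite /w /bit => /asboolPn; apply; exists t.
move=> tfalse; move: wt => /negbFE/asboolP[p [Pp pt ptrue]].
have {}pt : p = t by apply: idx_inj => //; exact/mem_set.
move: ptrue; rewrite pt => ttrue.
have := disj _ _ ttrue tfalse.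
by rewrite -!coorS// eqxx.
Qed.

(** * Finite covers by balls, built along digit words *)

Section BallCovers.
Context (R : realType).
Implicit Types (l : seq (R * R)).

Definition covered l := [set t : R | has (fun p => `|t - p.1| <= p.2) l].

Definition weight l := \sum_(p <- l) `|p.2|.

Lemma covered_cons p l :
  covered (p :: l) = `[p.1 - p.2, p.1 + p.2]%classic `|` covered l.
Proof.
apply/seteqP; split=> t; rewrite /covered /= in_itv/= ler_distl.
  by move=> /orP.
by case=> [->//|->]; rewrite orbT.
Qed.

Lemma measurable_covered l : measurable (covered l).
Proof.
elim: l => [|p l IH].
  by rewrite (_ : covered _ = set0)//; apply/seteqP; split.
by rewrite covered_cons; exact: measurableU.
Qed.

Lemma measure_covered l :
  (lebesgue_measure (covered l) <= (2 * weight l)%:E)%E.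
Proof.
elim: l => [|p l IH].
  by rewrite /weight big_nil mulr0 (_ : covered _ = set0) ?measure0//;
    apply/seteqP; split.
rewrite covered_cons /weight big_cons mulrDr EFinD.
set I := [set` _].
apply: (@le_trans _ _ (lebesgue_measure I + lebesgue_measure (covered l))%E).
  by apply: measureU2; [exact: measurable_itv|exact: (@measurable_covered l)].
apply: leeD => //; rewrite /I lebesgue_measure_itv /= lte_fin.
case: ifPn => [_|_]; last by rewrite lee_fin mulr_ge0.
by rewrite -EFinB lee_fin; have := ler_norm p.2; lra.
Qed.

Context (m : nat) (a b : 'I_m -> R) (base : R -> seq (R * R))
  (next : 'I_m -> R -> R) (alive : pred R).

(* The state [s] is updated by [next] along the digits, and branches whose state
   is not [alive] are discarded. *)
Fixpoint cover n s := if n is k.+1 then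
    if alive s then
      flatten [seq [seq (a i * p.1 + b i, `|a i| * p.2)
        | p <- cover k (next i s)] | i <- index_enum 'I_m]
    else [::]
  else base s.

(** Supermartingale bound, with [|a i|] in the role of the probability of the digit [i]. The
    Chernoff bound uses [q < 1], optional stopping uses [q = 1]. *)
Lemma weight_cover (V : R -> R) (q : R) : 0 <= q -> (forall s, 0 <= V s) ->
    (forall s, weight (base s) <= V s) ->
    (forall s, alive s -> \sum_i `|a i| * V (next i s) <= q * V s) ->
  forall n s, weight (cover n s) <= q ^+ n * V s.
Proof.
move=> q0 V0 baseV VV; elim=> [|n IH] s; first by rewrite mul1r.
rewrite /=; case: ifPn => [sa|_]; last first.
  by rewrite /weight big_nil mulr_ge0 ?exprn_ge0.
rewrite /weight big_flatten big_map /= exprSr -mulrA.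
apply: (@le_trans _ _ (q ^+ n * \sum_i `|a i| * V (next i s))); last first.
  by rewrite ler_wpM2l ?exprn_ge0// VV.
rewrite big_distrr /=; apply: ler_sum => i _; rewrite big_map /=.
under eq_bigr do rewrite normrM normr_id.
by rewrite -big_distrr /= mulrCA ler_wpM2l// IH.
Qed.

(** The cover follows every digit word, in particular the digits of the given point; the starting
    stage [k] is kept general for the induction. *)
Lemma covered_cover (i : nat -> 'I_m) (x s : nat -> R) n k :
    (forall j, x j = a (i j) * x j.+1 + b (i j)) ->
    (forall j, s j.+1 = next (i j) (s j)) ->
    (forall j, (j < k + n)%N -> alive (s j)) ->
  covered (base (s (k + n)%N)) (x (k + n)%N) -> covered (cover n (s k)) (x k).
Proof.
move=> xS sS; elim: n k => [|n IH] k sa; first by rewrite addn0.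
rewrite addnS -addSn => /IH {}IH; rewrite /= sa; last first.
  by rewrite addnS ltnS leq_addr.
have /hasP[p pl xp] : covered (cover n (s k.+1)) (x k.+1).
  by apply: IH => j jk; apply: sa; rewrite addnS -addSn.
apply/hasP; exists (a (i k) * p.1 + b (i k), `|a (i k)| * p.2).
  apply/flattenP; eexists.
    by apply/mapP; exists (i k); rewrite ?mem_index_enum.
  by apply/mapP; exists p; rewrite -?sS.
rewrite /= xS; have -> : forall y z, a (i k) * y + b (i k) -
  (a (i k) * z + b (i k)) = a (i k) * (y - z) by move=> y z; ring.
by rewrite normrM ler_wpM2l.
Qed.

End BallCovers.

(** * Criteria for null sets *)

Section NullSets.
Context (R : realType).
Local Notation mu := (@lebesgue_measure R).

Lemma nneseries_geometric_lty (K q : R) : 0 <= K -> 0 <= q < 1 ->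
  (\sum_(n <oo) (K * q ^+ n)%:E < +oo)%E.
Proof.
move=> K0 /andP[q0 q1].
apply: (@le_lt_trans _ _ (K / (1 - q))%:E); last exact: ltry.
apply: lime_le.
  by apply: is_cvg_nneseries => n _ _; rewrite lee_fin mulr_ge0 ?exprn_ge0.
apply: nearW => n; rewrite sumEFin lee_fin ler_pdivlMr ?subr_gt0//.
have -> : (\sum_(0 <= i < n) K * q ^+ i) * (1 - q) = K * (1 - q ^+ n).
  elim: n => [|n IH]; first by rewrite big_geq// mul0r expr0 subrr mulr0.
  by rewrite big_nat_recr //= mulrDl IH exprS; ring.
by rewrite ler_piMr// lerBlDr lerDl exprn_ge0.
Qed.

(** First Borel-Cantelli lemma: the measures are dominated by a geometric series. *)
Lemma limsup_covered_negligible (l : nat -> seq (R * R)) (K q : R) :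
  0 <= K -> 0 <= q < 1 -> (forall n, weight (l n) <= K * q ^+ n) ->
  mu.-negligible [set t | forall N, exists2 n, (N <= n)%N & covered (l n) t].
Proof.
move=> K0 q01 lK; exists (lim_sup_set (fun n => covered (l n))); split.
- apply: bigcap_measurable => // N _; apply: bigcup_measurable => n _.
  exact: (@measurable_covered _).
- apply: lim_sup_set_cvg0 => [n|]; first exact: (@measurable_covered _).
  apply: (le_lt_trans _ (@nneseries_geometric_lty (2 * K) q _ q01)); last first.
    by rewrite mulr_ge0.
  apply: lee_nneseries => // n _; apply: (le_trans (measure_covered _)).
  by rewrite lee_fin -mulrA ler_wpM2l.
- by move=> t H N _; have [n Nn tn] := H N; exists n.
Qed.

(** Continuity from below: the inner intersections increase with [N], and each lies in [F N]. *)
Lemma measure_liminf_le (F : nat -> set R) (e : \bar R) :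
  (forall n, measurable (F n)) -> (forall n, (mu (F n) <= e)%E) ->
  (mu (\bigcup_N \bigcap_(n >= N) F n) <= e)%E.
Proof.
move=> mF Fe; pose G N := \bigcap_(n >= N) F n.
have mG N : measurable (G N) by apply: bigcap_measurableType.
have GG : nondecreasing_seq G.
  move=> N M NM; apply/subsetPset => t Gt n /= Mn; apply: Gt.
  exact: leq_trans Mn.
have mUG : measurable (\bigcup_N G N) by exact: bigcup_measurable.
have Glim := @nondecreasing_cvg_mu _ _ _ mu G mG mUG GG.
rewrite -/(\bigcup_N G N).
move/cvg_lim : (Glim) => <- //; apply: lime_le.
  by apply/cvg_ex; eexists; exact: Glim.
apply: nearW => N; apply: le_trans (Fe N).
apply: le_measure; [apply/mem_set; exact: mG|apply/mem_set; exact: mF|].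
by apply: bigcap_inf => /=.
Qed.

Lemma negligible_small (Z : set R) (C : R) :
  (forall M : nat, exists A, [/\ measurable A, Z `<=` A &
     (mu A <= (C / M.+1%:R)%:E)%E]) ->
  mu.-negligible Z.
Proof.
move=> /choice[A HA]; exists (\bigcap_M A M); split.
- by apply: bigcap_measurable => // M _; have [] := HA M.
- apply/eqP; rewrite eq_le measure_ge0 andbT; apply/lee_addgt0Pr => e e0.
  rewrite add0e; have [M MC] : exists M : nat, C / M.+1%:R <= e.
    exists (Num.bound (`|C| / e)); rewrite ler_pdivrMr ?ltr0Sn//.
    rewrite (le_trans (ler_norm _))// mulrC -ler_pdivrMr//.
    have : `|C| / e < (Num.bound (`|C| / e))%:R.
      by apply: archi_boundP; rewrite divr_ge0// ltW.
    by rewrite -natr1; lra.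
  have [mA _ AC] := HA M.
  apply: (@le_trans _ _ (mu (A M))).
    apply: le_measure; last exact: bigcap_inf; apply/mem_set; last exact: mA.
    by apply: bigcap_measurable => // k _; have [] := HA k.
  by apply: (le_trans AC); rewrite lee_fin.
- by move=> t Zt M _; have [_ + _] := HA M; apply.
Qed.

End NullSets.

(** * Exponential moments and the mean logarithmic ratio *)

Lemma expR_le_quadratic (R : realType) (y : R) :
  y <= 1 / 2 -> expR y <= 1 + y + 2 * y ^+ 2.
Proof.
(* Inverted, this gives [expR y <= 1 / (1 - y)], and the quadratic times [1 - y] exceeds 1 by
   [y ^+ 2 * (1 - 2 * y)]. *)
move=> y2; have : 1 - y <= expR (- y) by rewrite expR_ge1Dx.
have y1 : 0 < 1 - y by lra.
rewrite -(ler_pM2l (expR_gt0 y)) expRN divff ?gt_eqF ?expR_gt0// => expy.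
rewrite -(ler_pM2r y1) (le_trans expy)// -subr_ge0.
have -> : (1 + y + 2 * y ^+ 2) * (1 - y) - 1 = y ^+ 2 * (1 - 2 * y) by ring.
by rewrite mulr_ge0 ?sqr_ge0//; lra.
Qed.

(** As a function of [s] the moment is 1 at 0 and has the negative derivative [mu] there; the
    quadratic bound on [expR] makes this effective. *)
Lemma exp_moment_lt1 (R : realType) (m : nat) (c Y : 'I_m -> R) :
  (forall i, 0 < c i) -> \sum_i c i = 1 -> \sum_i c i * Y i < 0 ->
  exists2 s, 0 < s <= 1 & \sum_i c i * expR (s * Y i) < 1.
Proof.
move=> c0 c1; set mu := \sum_i _ => mu0.
pose B := 1 + \sum_i `|Y i|.
have YB i : `|Y i| <= B.
  by rewrite /B (bigD1 i)//= addrCA lerDl addr_ge0// sumr_ge0.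
have B1 : 1 <= B by rewrite lerDl sumr_ge0.
have B0 : 0 < B by lra.
(* The first term keeps [s * Y i] in the range of the quadratic bound; the second makes the
   quadratic error at most half of the linear gain [- s * mu]. *)
pose s := Num.min (1 / (2 * B)) (- mu / (4 * B ^+ 2)).
have s0 : 0 < s.
  by rewrite lt_min !divr_gt0 ?oppr_gt0// mulr_gt0// exprn_gt0.
have sB : s * B <= 1 / 2.
  have : s <= 1 / (2 * B) by rewrite ge_min lexx.
  rewrite ler_pdivlMr ?mulr_gt0//; lra.
have smu : 4 * (s * B ^+ 2) <= - mu.
  have : s <= - mu / (4 * B ^+ 2) by rewrite ge_min lexx orbT.
  by rewrite ler_pdivlMr ?mulr_gt0 ?exprn_gt0//; lra.
exists s.
  rewrite s0 /=; have : s <= s * B by rewrite ler_peMr// ltW.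
  lra.
have bound i : c i * expR (s * Y i) <=
    c i + s * (c i * Y i) + 2 * (s * B) ^+ 2 * c i.
  have : expR (s * Y i) <= 1 + s * Y i + 2 * (s * Y i) ^+ 2.
    apply: expR_le_quadratic; apply: le_trans sB; rewrite ler_pM2l//.
    exact: le_trans (ler_norm _) (YB i).
  have : (s * Y i) ^+ 2 <= (s * B) ^+ 2.
    rewrite -[X in X <= _]real_normK ?num_real// lerXn2r ?nnegrE//.
      exact: mulr_ge0 (ltW s0) (ltW B0).
    by rewrite normrM gtr0_norm// ler_pM2l.
  move=> H1 H2; have : expR (s * Y i) <= 1 + s * Y i + 2 * (s * B) ^+ 2 by lra.
  rewrite -(ler_pM2l (c0 i)) => /le_trans; apply.
  by rewrite le_eqVlt; apply/orP; left; apply/eqP; ring.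
apply: (le_lt_trans (ler_sum _ (fun i _ => bound i))).
rewrite !big_split /= -!big_distrr /= c1 -/mu mulr1.
have : s * (4 * (s * B ^+ 2)) <= s * (- mu) by rewrite ler_pM2l.
have : 0 < s * - mu by rewrite mulr_gt0// oppr_gt0.
rewrite exprMn expr2; lra.
Qed.

(** Replaces the logarithms, possibly [-oo], by real upper bounds whose mean is still negative, with
    a margin [dl] to spare. *)
Lemma mean_log_ratio_lt0 (R : realType) (m : nat) (lam c : 'I_m -> R) :
  (forall i, 0 <= lam i) -> (forall i, 0 < c i) -> \sum_i c i = 1 ->
  (mean_log_ratio lam c < 0)%E ->
  exists Y dl, [/\ 0 < dl, \sum_i c i * Y i < 0 &
    forall i, lam i / c i <= expR (Y i - dl)].
Proof.
move=> lam0 c0 c1 mean0.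
suff [X [XN lamX]] : exists X, \sum_i c i * X i < 0 /\
    forall i, lam i / c i <= expR (X i).
  (* Half of the negative mean is kept in [Y], the other half becomes [dl]. *)
  exists (fun i => X i - (\sum_i c i * X i) / 2), (- (\sum_i c i * X i) / 2).
  split=> [||i]; first by rewrite mulNr oppr_gt0; lra.
    under eq_bigr do rewrite mulrBr.
    by rewrite sumrB -big_distrl /= c1; lra.
  by rewrite mulNr opprK subrK.
have [lamp|] := pselect (forall i, 0 < lam i).
  exists (fun i => ln (lam i / c i)); split=> [|i]; last first.
    by rewrite lnK// posrE divr_gt0.
  rewrite -lte_fin -sumEFin; move: mean0; rewrite /mean_log_ratio.
  by under eq_bigr do rewrite lne_EFin ?divr_gt0// -EFinM.
move=> /existsNP[j /negP]; rewrite -leNgt => lamj.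
have {lamj} lamj : lam j = 0 by apply/eqP; rewrite eq_le lamj lam0.
pose M := \sum_i c i * `|ln (lam i / c i)|.
have M0 : 0 <= M by apply: sumr_ge0 => i _; rewrite mulr_ge0// ltW.
(* A zero ratio is bounded by the exponential of any number; this value contributes [- (1 + M)] at
   [j], while the other terms add up to at most [M]. *)
exists (fun i => if 0 < lam i then ln (lam i / c i) else - ((1 + M) / c j)).
split=> [|i]; last first.
  case: ifPn => [lami|]; first by rewrite lnK// posrE divr_gt0.
  rewrite -leNgt => lami; apply: (@le_trans _ _ 0); last exact: expR_ge0.
  by rewrite mulr_le0_ge0// invr_ge0 ltW.
rewrite (bigD1 j)//= lamj ltxx mulrN mulrCA divff ?gt_eqF// mulr1.
have : \sum_(i < m | i != j) c i *
    (if 0 < lam i then ln (lam i / c i) else - ((1 + M) / c j)) <= M.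
  rewrite /M [X in _ <= X](bigD1 j)//= -[X in X <= _]add0r.
  apply: lerD; first by rewrite mulr_ge0// ltW.
  apply: ler_sum => i _; rewrite ler_pM2l//; case: ifPn => _.
    exact: ler_norm.
  apply: (@le_trans _ _ 0) => //.
  by rewrite oppr_le0 divr_ge0 ?(ltW (c0 j))// addr_ge0.
lra.
Qed.

Lemma mean_log_ratio_ge0 (R : realType) (m : nat) (lam c : 'I_m -> R) :
  (forall i, 0 < c i) -> (0 <= mean_log_ratio lam c)%E ->
  (forall i, 0 < lam i) /\ 0 <= \sum_i c i * ln (lam i / c i).
Proof.
move=> c0 mean0; have lamp i : 0 < lam i.
  rewrite ltNge; apply/negP => lami; move: mean0.
  rewrite /mean_log_ratio (bigD1 i)//= ifT; last first.
    by rewrite pmulr_lle0// invr_gt0.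
  by rewrite gt0_muleNy ?lte_fin// addNye.
split=> //; rewrite -lee_fin -sumEFin; move: mean0; rewrite /mean_log_ratio.
by under eq_bigr do rewrite lne_EFin ?divr_gt0// -EFinM.
Qed.

(** * The self-affine function: pieces, endpoint values and digit expansions *)

Section SelfAffine.
Context (R : realType) (d m : nat) (hd : (1 <= d)%N) (hm : (2 <= m)%N)
  (eps : 'I_m -> bool) (S : 'I_m -> 'rV[R]_d -> 'rV[R]_d)
  (lam c : 'I_m -> R) (f : R -> 'rV[R]_d).
Context (hS : forall i, contractive_similitude (S i) (lam i))
  (hfirst : forall i : 'I_m, (i : nat) = 0%N ->
     S i (start_pt R d (eps i)) = pt_a R d)
  (hlast : forall i : 'I_m, i.+1 = m ->
     S i (end_pt R d (eps i)) = pt_b R d)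
  (hc : forall i, 0 < c i)
  (hc1 : \sum_(i < m) c i = 1)
  (hlamc : lam <> c)
  (hfcont : {within `[0, 1], continuous f})
  (hf : forall (i : 'I_m) (t : R), piece eps c i t ->
     f t = S i (f (phi_inv eps c i t))).

Definition slope i := (-1) ^+ eps i * c i.
Definition offset i := sigma eps c i.
Definition prefix_sum k := \sum_(j < m | (j < k)%N) c j.

Lemma norm_slope i : `|slope i| = c i.
Proof. by rewrite normrM normrX normrN1 expr1n mul1r gtr0_norm. Qed.

Lemma slope_neq0 i : slope i != 0.
Proof. by rewrite -normr_eq0 norm_slope gt_eqF. Qed.

Lemma prefix_sum_ge0 k : 0 <= prefix_sum k.
Proof. by apply: sumr_ge0 => j _; exact: ltW. Qed.

Lemma prefix_sumS (i : 'I_m) : prefix_sum i.+1 = prefix_sum i + c i.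
Proof.
rewrite /prefix_sum (bigD1 i)//= addrC; congr (_ + _); apply: eq_bigl => j.
by rewrite ltnS [RHS]ltn_neqAle andbC.
Qed.

Lemma prefix_sum_le1 k : prefix_sum k <= 1.
Proof.
rewrite -hc1 /prefix_sum big_mkcond /=; apply: ler_sum => j _.
by case: ifP => // _; exact: ltW.
Qed.

(** Separates position from orientation: the piece starts at [prefix_sum i] in both cases, and the
    sign only reflects [x]. *)
Lemma slope_offsetE (i : 'I_m) x : slope i * x + offset i =
  prefix_sum i + c i * (if eps i then 1 - x else x).
Proof.
rewrite /slope /offset /sigma -/(prefix_sum i); case: (eps i) => /=.
  by rewrite expr1; ring.
by rewrite expr0; ring.
Qed.

Lemma phi_unit (i : 'I_m) x : 0 <= x <= 1 -> 0 <= slope i * x + offset i <= 1.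
Proof.
move=> x01; rewrite slope_offsetE.
have := prefix_sum_ge0 i; have := prefix_sum_le1 i.+1.
rewrite prefix_sumS; set y := if _ then _ else _.
have y01 : 0 <= y <= 1 by rewrite /y; case: ifP; lra.
have : 0 <= c i * y by rewrite mulr_ge0 ?(ltW (hc i))//; lra.
have : c i * y <= c i * 1 by rewrite ler_pM2l//; lra.
lra.
Qed.

Lemma phi_cover t : 0 <= t <= 1 ->
  exists p : 'I_m * R, 0 <= p.2 <= 1 /\ t = slope p.1 * p.2 + offset p.1.
Proof.
move=> /andP[t0 t1].
have exk : exists k, (k < m)%N && (t <= prefix_sum k.+1).
  exists m.-1; rewrite prednK ?leqnn ?(leq_trans _ hm)//=.
  rewrite (le_trans t1)// -hc1 /prefix_sum le_eqVlt; apply/orP; left; apply/eqP.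
  by apply: eq_bigl => j; rewrite ltn_ord.
case: (ex_minnP exk) => k /andP[km tk] kmin.
have prek : prefix_sum k <= t.
  case: k => [|k] in km tk kmin *; first by rewrite /prefix_sum big_pred0.
  rewrite leNgt; apply/negP => tk'; have := kmin k.
  by rewrite (ltW tk') (ltnW km) ltnn => /(_ isT).
pose i := Ordinal km; have prei : prefix_sum i <= t by [].
move: tk; rewrite -/(prefix_sum i.+1) (prefix_sumS i) => tk.
pose y := (t - prefix_sum i) / c i.
have y0 : 0 <= y by rewrite divr_ge0 ?subr_ge0// ltW.
have y1 : y <= 1 by rewrite ler_pdivrMr// mul1r; lra.
have ty : t = prefix_sum i + c i * y by rewrite /y mulrC divfK ?gt_eqF// subrKC.
exists (i, if eps i then 1 - y else y); split=> /=; first by case: ifP; lra.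
by rewrite slope_offsetE ty; case: (eps i); congr (_ + _ * _); ring.
Qed.

Lemma f_phi (i : 'I_m) x :
  0 <= x <= 1 -> f (slope i * x + offset i) = S i (f x).
Proof.
move=> x01; rewrite (@hf i).
  by rewrite -/(phi eps c i x) phiK// gt_eqF.
by exists x; rewrite //= in_itv.
Qed.

Lemma phi_scales (i : 'I_m) : scales f (slope i) (offset i) (lam i).
Proof.
have [/andP[l0 _] Sl] := hS i.
split=> // [|x x01|x y x01 y01]; [exact: slope_neq0|exact: phi_unit|].
by rewrite !f_phi// Sl.
Qed.

Lemma m_gt0 : (0 < m)%N. Proof. exact: leq_trans hm. Qed.

(** The functional equation at 0 and 1 expresses each of the errors [enorm (f 0)] and
    [enorm (f 1 - pt_b R d)] as a ratio below 1 times one of the two, which one depending on the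
    signature; hence both vanish. *)
Lemma f_endpoints : f 0 = 0 /\ f 1 = pt_b R d.
Proof.
have m0 := m_gt0; pose i0 := Ordinal m0.
have mm : (m.-1 < m)%N by rewrite prednK.
pose i1 := Ordinal mm.
have i1m : i1.+1 = m by rewrite /= prednK.
have e01 (b : bool) : 0 <= (b%:R : R) <= 1 by case: b; rewrite ?lexx ?ler01.
have F0 : f 0 = S i0 (f (eps i0)%:R).
  rewrite -f_phi// slope_offsetE /prefix_sum big_pred0//.
  by case: (eps i0); rewrite ?subrr mulr0 addr0.
have F1 : f 1 = S i1 (f (~~ eps i1)%:R).
  rewrite -f_phi// slope_offsetE; have := prefix_sumS i1; rewrite i1m.
  have -> : prefix_sum m = 1.
    by rewrite -hc1 /prefix_sum; apply: eq_bigl => j; rewrite ltn_ord.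
  move=> pi1.
  rewrite -/i1 [in RHS](_ : (if _ then _ else _) = 1) ?mulr1 -?pi1//.
  by case: (eps i1); rewrite /= ?subr0.
have [/andP[_ l0] S0] := hS i0; have [/andP[_ l1] S1] := hS i1.
have A0 : enorm (f 0) = lam i0 * enorm (f (eps i0)%:R - start_pt R d (eps i0)).
  by rewrite -S0 -F0 hfirst// /pt_a subr0.
have A1 : enorm (f 1 - pt_b R d) =
    lam i1 * enorm (f (~~ eps i1)%:R - end_pt R d (eps i1)).
  by rewrite -S1 -F1 hlast.
have sE (b : bool) : f b%:R - start_pt R d b =
    if b then f 1 - pt_b R d else f 0.
  rewrite /start_pt /pt_a scaler0 add0r.
  by case: b; rewrite ?scale1r ?scale0r ?subr0.
have eE (b : bool) : f (~~ b)%:R - end_pt R d b =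
    if b then f 0 else f 1 - pt_b R d.
  rewrite /end_pt /pt_a scaler0 add0r.
  by case: b; rewrite /= ?subrr ?subr0 ?scale1r ?scale0r ?subr0.
rewrite sE in A0; rewrite eE in A1.
have P0 := enorm_ge0 (f 0); have P1 := enorm_ge0 (f 1 - pt_b R d).
have contr (l u v : R) : 0 <= u -> 0 <= v -> 0 <= l < 1 -> u = l * v -> u <= v.
  by move=> u0 v0 /andP[l0' l1'] ->; rewrite ler_piMl// ltW.
have contr0 (l u : R) : 0 <= l < 1 -> u = l * u -> u = 0.
  by move=> /andP[_ l1'] ul; apply/eqP; have : (1 - l) * u == 0;
    [rewrite mulrBl -ul mul1r subrr|rewrite mulf_eq0 subr_eq0 gt_eqF].
have [h0 _] := hS i0; have [h1 _] := hS i1.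
suff [E0 E1] : enorm (f 0) = 0 /\ enorm (f 1 - pt_b R d) = 0.
  split; first exact: enorm_eq0.
  by apply/eqP; rewrite -subr_eq0; apply/eqP/enorm_eq0.
(* When both outer pieces are reversed the errors bound each other, and the product of the two
   ratios is the contraction. *)
case: (eps i0) A0; case: (eps i1) A1 => A1 A0.
- have E : enorm (f 0) = 0.
    apply: (contr0 (lam i0 * lam i1)); last by rewrite -mulrA -A1.
    have [/andP[? ?] _] := hS i0; have [/andP[? ?] _] := hS i1.
    by rewrite mulr_ge0//= mulr_ilt1.
  by rewrite A1 E mulr0.
- by rewrite A0 (contr0 _ _ h1 A1) mulr0.
- by rewrite A1 (contr0 _ _ h0 A0) mulr0.
- by rewrite (contr0 _ _ h1 A1) (contr0 _ _ h0 A0).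
Qed.

(** With this normalization the chord over a cylinder has slope exactly [lam_w / c_w]. *)
Lemma enorm_f0_f1 : enorm (f 0 - f 1) = 1.
Proof.
have [-> ->] := f_endpoints; rewrite sub0r -scaleN1r enormZ normrN1 mul1r.
rewrite /enorm (bigD1 (Ordinal hd))//= big1 => [|j jN0].
  by rewrite mxE /= expr1n addr0 sqrtr1.
rewrite mxE; case: eqP => [j0|_]; last by rewrite expr0n.
by case/eqP: jN0; apply: val_inj.
Qed.

(** At least two positive weights sum to 1, so each is below 1; the uniform bound makes cylinders
    shrink geometrically. *)
Lemma c_bound : exists2 q : R, 0 <= q < 1 & forall i, c i <= q.
Proof.
exists (\big[Num.max/0]_(i < m) c i); last first.
  by move=> i; apply/bigmax_geP; right; exists i.
apply/andP; split; first by apply/bigmax_geP; left.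
apply/bigmax_ltP; split=> [|i _]; first exact: ltr01.
have m0 := m_gt0; have [j ji] : exists j : 'I_m, j != i.
  have mm : (m.-1 < m)%N by rewrite prednK.
  have [i0|i0] := eqVneq (i : nat) 0%N.
    exists (Ordinal mm); apply: contraTneq hm => /(congr1 val) /=.
    by rewrite i0 => /eqP; rewrite -leqNgt -ltnS; case: (m) => // -[].
  by exists (Ordinal m_gt0); rewrite eq_sym; apply: contraNneq i0 => ->.
rewrite -hc1 (bigD1 i)//= (bigD1 j)//= ltrDl ltr_pwDl//.
by apply: sumr_ge0 => k _; exact: ltW.
Qed.

Lemma prod_slope_cvg0 (i : nat -> 'I_m) :
  \prod_(k < n) slope (i k) @[n --> \oo] --> (0 : R).
Proof.
have [q /andP[_ q1] cq] := c_bound.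
apply: (@prod_cvg0 _ (slope \o i) q) => // k.
by rewrite /= norm_slope.
Qed.

Definition digit_code (i : nat -> 'I_m) x :=
  code f (slope \o i) (offset \o i) (lam \o i) x.

(** The digits come from iterating a chosen inverse branch; at a common end of two pieces either
    digit will do. *)
Lemma exists_code t : 0 <= t <= 1 -> exists i x, digit_code i x /\ x 0%N = t.
Proof.
move=> t01.
have /choice[dig digP] : forall t, exists p : 'I_m * R, 0 <= t <= 1 ->
    0 <= p.2 <= 1 /\ t = slope p.1 * p.2 + offset p.1.
  move=> u; have [/phi_cover[p ?]|?] := pselect (0 <= u <= 1).
    by exists p.
  (* An arbitrary value off the unit interval, which the orbit of [t] never leaves. *)
  by exists (Ordinal m_gt0, 0).
pose x n := iter n (fun u => (dig u).2) t.
have x01 n : 0 <= x n <= 1 by elim: n => // n /digP[].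
exists (fun n => (dig (x n)).1), x; split=> // n.
by split; [|have [] := digP _ (x01 n)|exact: phi_scales].
Qed.

Lemma norm_prod_slope (i : nat -> 'I_m) n :
  `|\prod_(k < n) slope (i k)| = \prod_(k < n) c (i k).
Proof. by rewrite normr_prod; apply: eq_bigr => k _; rewrite norm_slope. Qed.

(* Comparing the slopes of [f] on the cylinder of order [n] around [t] and on
   its [j]-th subcylinder: both converge to [f'(t)], and their ratio is
   [lam j / c j]. *)
Lemma derivative_eq0 i x v : digit_code i x -> has_derivative f (x 0%N) v ->
  v = 0 /\ \prod_(k < n) (lam (i k) / c (i k)) @[n --> \oo] --> (0 : R).
Proof.
move=> ix fv; have slopes := code_slope_cvg ix (prod_slope_cvg0 i) fv.
have zero01 : 0 <= (0 : R) <= 1 by rewrite lexx ler01.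
have one01 : 0 <= (1 : R) <= 1 by rewrite lexx ler01.
have r_cvg : \prod_(k < n) (lam (i k) / c (i k)) @[n --> \oo] --> enorm v.
  have := slopes 0 1 zero01 one01.
  rewrite eq_sym oner_eq0 enorm_f0_f1 sub0r normrN1.
  move=> /(_ isT); apply: cvg_trans; apply: near_eq_cvg.
  apply: nearW => n /=; rewrite divr1 mulr1.
  by apply: eq_bigr => k _; rewrite norm_slope.
suff v0 : enorm v = 0 by rewrite v0 in r_cvg; split=> //; exact: enorm_eq0.
(* If [enorm v] were nonzero, the two limits below would give [lam j / c j = 1] for every [j]. *)
apply/eqP; apply: contra_notT hlamc => v0; apply/funext => j.
have [_ _ _ fj] := phi_scales j.
have d01 : slope j * 0 + offset j - (slope j * 1 + offset j) = - slope j.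
  by ring.
have lim1 : \prod_(k < n) (lam (i k) / c (i k)) * (lam j / c j) @[n --> \oo]
    --> enorm v.
  have := slopes _ _ (phi_unit j zero01) (phi_unit j one01).
  rewrite -subr_eq0 d01 oppr_eq0 => /(_ (slope_neq0 j)).
  rewrite fj// enorm_f0_f1.
  rewrite mulr1 normrN norm_slope; apply: cvg_trans; apply: near_eq_cvg.
  apply: nearW => n /=; congr (_ * _).
  by apply: eq_bigr => k _; rewrite norm_slope.
have lim2 : \prod_(k < n) (lam (i k) / c (i k)) * (lam j / c j) @[n --> \oo]
    --> enorm v * (lam j / c j) by apply: cvgM => //; exact: cvg_cst.
have E : enorm v * (lam j / c j) = enorm v.
  exact: (@cvg_unique _ (@Rhausdorff R) _ _ _ _ lim2 lim1).
move/eqP: E.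
rewrite -subr_eq0 -{2}[enorm v]mulr1 -mulrBr mulf_eq0 (negPf v0) subr_eq0.
by move=> /eqP lc1; rewrite -[c j]mul1r -lc1 divfK ?gt_eqF.
Qed.

(** * Nondifferentiability everywhere, and on an uncountable set *)

Lemma in_unit (t : R) : 0 < t < 1 -> 0 <= t <= 1.
Proof. by move=> /andP[/ltW -> /ltW]. Qed.

Lemma lam_ge0 i : 0 <= lam i.
Proof. by have [/andP[]] := hS i. Qed.

(** A product of factors at least 1 cannot tend to 0. *)
Lemma nowhere_differentiable : (forall i, c i <= lam i) ->
  forall t : R, 0 < t < 1 -> ~ differentiable_at f t.
Proof.
move=> clam t /in_unit/exists_code[i [x [ix <-]]] /derivable_has_derivative[v].
move=> /(derivative_eq0 ix)[_ /cvgrPdist_lt/(_ 1 ltr01)[n _ /(_ n (leqnn n))]].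
rewrite /= sub0r normrN ltNge => /negP; apply.
apply: le_trans (ler_norm _).
elim: n => [|n IH]; first by rewrite big_ord0.
rewrite big_ord_recr /= -[X in X <= _]mulr1; apply: ler_pM => //.
by rewrite ler_pdivlMr// mul1r.
Qed.

(** Every derivative of [f] is zero, so countably many exceptions would make the first coordinate
    nonincreasing, although it goes from 0 to 1. *)
Lemma uncountable_nondifferentiable :
  ~ countable [set t : R | 0 < t < 1 /\ ~ differentiable_at f t].
Proof.
move=> ctbl; pose o := Ordinal hd.
have fo01 : f 1 0 o <= f 0 0 o.
  apply: (@zero_derivative_nonincreasing _ (fun t => f t 0 o) 0 1 _ ltr01
    (within_continuous_coord hfcont) ctbl) => t t01 tC.
  have /derivable_has_derivative[v fv] : differentiable_at f t.
    by apply: contrapT => ?; apply: tC.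
  have [i [x [ix xt]]] := exists_code (in_unit t01).
  rewrite -xt in fv; have [v0 _] := derivative_eq0 ix fv.
  rewrite xt v0 in fv => e e0; have [dl dl0 H] := fv e e0; exists dl => // y yt.
  apply: le_trans (H y yt); rewrite !scaler0 !subr0.
  by have := coord_le_norm (f y - f t) o; rewrite !mxE.
by move: fo01; have [-> ->] := f_endpoints; rewrite !mxE /= ler10.
Qed.

(** * Zero derivative almost everywhere *)

Lemma f_bounded : exists2 D, 0 <= D &
  forall y z, 0 <= y <= 1 -> 0 <= z <= 1 -> enorm (f y - f z) <= D.
Proof.
have /compact_bounded[M [_ HM]] : compact (f @` `[0, 1]).
  by apply: continuous_compact => //; exact: segment_compact.
have fM y : 0 <= y <= 1 -> `|f y| <= `|M| + 1.
  move=> y01; apply: HM; last by exists y => //=; rewrite in_itv.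
  by rewrite (le_lt_trans (ler_norm _))// ltrDl.
exists (Num.sqrt d%:R * (2 * (`|M| + 1))).
  by rewrite mulr_ge0 ?sqrtr_ge0// mulr_ge0// addr_ge0.
move=> y z y01 zero01; apply: (le_trans (enorm_le_norm _)).
rewrite ler_wpM2l ?sqrtr_ge0// (le_trans (ler_normB _ _))//.
by have := fM y y01; have := fM z zero01; lra.
Qed.

(** The covers of order [n] catch the points for which [x n] is within [sn n] of an end of a piece.
    Their weight decays like [q ^+ n], so almost every point is caught finitely often, and then
    [sn n] serves as the gap in [code_zero_derivative]. *)
Lemma ae_zero_derivative : (mean_log_ratio lam c < 0)%E ->
  {ae lebesgue_measure, forall t : R, 0 < t < 1 -> zero_derivative_at f t}.
Proof.
move=> mean0.
have [Y [dl [dl0 Y0 lamY]]] := mean_log_ratio_lt0 lam_ge0 hc hc1 mean0.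
have [s /andP[s0 s1] q1] := exp_moment_lt1 hc hc1 Y0.
set q := \sum_i _ in q1.
have q0 : 0 <= q by apply: sumr_ge0 => i _; rewrite mulr_ge0 ?expR_ge0// ltW.
have [D D0 fD] := f_bounded.
(* Balls of radius [y] about both ends of every piece. *)
pose base (y : R) := [seq (offset j, y) | j <- index_enum 'I_m] ++
  [seq (slope j + offset j, y) | j <- index_enum 'I_m].
pose next i y := y * expR (s * Y i).
pose V (y : R) := `|y| *+ m + `|y| *+ m.
have V0 y : 0 <= V y by rewrite addr_ge0// mulrn_wge0.
have baseV y : weight (base y) <= V y.
  by rewrite /weight big_cat !big_map /= !sumr_const card_ord.
have nextV y : predT y -> \sum_i `|slope i| * V (next i y) <= q * V y.
  move=> _; rewrite /q big_distrl /=; apply: ler_sum => i _.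
  rewrite norm_slope /V /next normrM (gtr0_norm (expR_gt0 _)).
  rewrite le_eqVlt; apply/orP; left; apply/eqP.
  by rewrite -!mulrnAr; ring.
pose l n := cover slope offset base next predT n 1.
have lV n : weight (l n) <= V 1 * q ^+ n.
  by rewrite mulrC; apply: weight_cover.
have q01 : 0 <= q < 1 by rewrite q0.
have := limsup_covered_negligible (V0 1) q01 lV.
apply: negligibleS => t /=; apply: contra_notP => /existsNP[N HN] t01.
 have [i [x [ix xt]]] := exists_code (in_unit t01).
pose Ys n := \sum_(k < n) Y (i k).
pose sn n := expR (s * Ys n).
have snS n : sn n.+1 = next (i n) (sn n).
  by rewrite /sn /Ys big_ord_recr /= mulrDr expRD.
have ball_notin n : (N <= n)%N -> ~ covered (base (sn n)) (x n).
  move=> Nn /(@covered_cover _ _ _ _ _ next predT i x sn n 0) xl; apply: HN.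
  exists n => //; rewrite -xt /l.
  have -> : 1 = sn 0%N by rewrite /sn /Ys big_ord0 mulr0 expR0.
  by apply: xl => // j; have [] := ix j.
have far n p : (N <= n)%N -> (p, sn n) \in base (sn n) -> sn n < `|x n - p|.
  move=> Nn pb; rewrite ltNge; apply/negP => xp; apply: (ball_notin _ Nn).
  by apply/hasP; exists (p, sn n).
have sn_gt0 n : 0 < sn n := expR_gt0 _.
have x01 n : 0 <= x n <= 1 by have [] := ix n.
have far_left n : (N <= n)%N -> sn n < `|x n - offset (i n)|.
  move=> Nn; apply: far => //; rewrite mem_cat; apply/orP; left.
  by apply/mapP; exists (i n); rewrite ?mem_index_enum.
have far_right n : (N <= n)%N -> sn n < `|x n - (slope (i n) + offset (i n))|.
  move=> Nn; apply: far => //; rewrite mem_cat; apply/orP; right.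
  by apply/mapP; exists (i n); rewrite ?mem_index_enum.
(* The gap [sn n] is below a distance between points of the unit interval, hence at most 1. *)
have Ys_le0 n : (N <= n)%N -> Ys n <= 0.
  move=> Nn; rewrite -(pmulr_rle0 _ s0) -expR_le1.
  have := phi_unit (i n) (_ : 0 <= (0 : R) <= 1).
  rewrite lexx ler01 mulr0 add0r.
  move=> /(_ isT) offset01; have := x01 n; have := far_left n Nn.
  rewrite -/(sn n).
  by rewrite lter_normr => /orP[] ? ?; lra.
have prod_lam n : \prod_(k < n) lam (i k) <=
    (\prod_(k < n) c (i k)) * expR (Ys n - dl *+ n).
  elim: n => [|n IH].
    by rewrite !big_ord0 /Ys big_ord0 subrr expR0 mulr1.
  rewrite !big_ord_recr /= /Ys big_ord_recr /= mulrS.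
  have -> : \sum_(k < n) Y (i k) + Y (i n) - (dl + dl *+ n) =
    (Ys n - dl *+ n) + (Y (i n) - dl) by rewrite /Ys; ring.
  rewrite expRD mulrACA; apply: ler_pM => //; [|exact: lam_ge0|].
    by apply: prodr_ge0 => k _; exact: lam_ge0.
  by rewrite mulrC -ler_pdivrMr.
rewrite -xt; apply: has_derivative_is_derive.
apply: (@code_zero_derivative _ _ _ _ _ _ _ ix D
  (fun n => D * expR (- dl) ^+ n) sn N (prod_slope_cvg0 i) fD) => [n Nn|n Nn|].
- by split; rewrite ?sn_gt0// ltW ?far_left ?far_right.
- rewrite norm_prod_slope.
  apply: (@le_trans _ _ (D * (\prod_(k < n) c (i k) * expR (Ys n - dl *+ n)))).
    by rewrite ler_wpM2l.
  rewrite -!mulrA ler_wpM2l// mulrCA ler_wpM2l//.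
    by apply: prodr_ge0 => k _; exact: ltW.
  (* Since [s <= 1] and [Ys n <= 0], [expR (Ys n)] is at most the gap [sn n]; the margin [dl] is
     left over as the vanishing factor. *)
  rewrite expRD mulrC -mulNrn -mulr_natl expRM_natl.
  rewrite ler_wpM2l ?exprn_ge0 ?expR_ge0//.
  by rewrite ler_expR ler_niMl// Ys_le0.
- rewrite -[0](mulr0 D); apply: cvgM; first exact: cvg_cst.
  apply: cvg_expr; rewrite ger0_norm ?expR_ge0// expR_lt1.
  by rewrite oppr_lt0.
Qed.

(** * Nondifferentiability almost everywhere, by optional stopping *)

Lemma ae_nondifferentiable : (0 <= mean_log_ratio lam c)%E ->
  {ae lebesgue_measure, forall t : R, 0 < t < 1 -> ~ differentiable_at f t}.
Proof.
move=> /(mean_log_ratio_ge0 hc)[lam_gt0 mean0].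
pose X i := ln (lam i / c i).
pose C := \sum_i `|X i|.
have XC i : X i <= C.
  by rewrite /C (bigD1 i)//= (le_trans (ler_norm _))// lerDl sumr_ge0.
have C0 : 0 <= C by exact: sumr_ge0.
pose W n (i : nat -> 'I_m) := \sum_(k < n) X (i k).
(* At a point of differentiability the walk [W] tends to [-oo], so it is bounded above and the point
   lies in some [Z K]. *)
pose Z (K : nat) := [set t : R | exists i x, [/\ digit_code i x, x 0%N = t,
  forall n, W n i < K%:R & forall M : nat, exists N, forall n, (N <= n)%N ->
    W n i <= - M%:R]].
have Z0 K : lebesgue_measure.-negligible (Z K).
  apply: (@negligible_small _ _ (2 * (K%:R + C))) => M.
  (* A walk ending at or below [- M.+1] contributes its whole cylinder, any other walk nothing. *)
  pose base (x : R) :=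
    if x <= - M.+1%:R then [:: (1 / 2 : R, 1 / 2 : R)] else [::].
  pose next i (x : R) := x + X i.
  pose alive (x : R) := x < K%:R.
  (* Optional stopping: [V x] dominates the probability that the walk started
     at [x] falls below [- M.+1] before exceeding [K]. *)
  pose V (x : R) := Num.max 0 (K%:R + C - x) / M.+1%:R.
  have M0 : 0 < M.+1%:R :> R by rewrite ltr0Sn.
  have V0 x : 0 <= V x by rewrite divr_ge0// le_max lexx.
  have baseV x : weight (base x) <= V x.
    rewrite /base; case: ifPn => [xM|_]; last by rewrite /weight big_nil.
    rewrite /weight big_seq1 /= ger0_norm// ler_pdivlMr// le_max.
    by apply/orP; right; have := ler0n R K; lra.
  have nextV x : alive x -> \sum_i `|slope i| * V (next i x) <= 1 * V x.
    rewrite /alive mul1r => xK.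
    (* One step from below [K] cannot pass [K + C], so [V] stays on its linear branch, where the
       nonnegative mean makes it decrease on average. *)
    have VE y : y <= K%:R + C -> V y = (K%:R + C - y) / M.+1%:R.
      by move=> yK; rewrite /V max_r// subr_ge0.
    rewrite VE; last by lra.
    under eq_bigr => i _.
      rewrite norm_slope VE; last by rewrite /next; have := XC i; lra.
      rewrite /next mulrA.
      rewrite (_ : c i * _ = c i * (K%:R + C - x) - c i * X i); last by ring.
      over.
    rewrite -big_distrl /= ler_wpM2r ?invr_ge0 ?ler0n//.
    by rewrite sumrB -big_distrl /= hc1 mul1r lerBlDr lerDl.
  (* On [Z K] the walk is eventually below [- M.+1], so its point lies in all covers of large
     order. *)
  exists (\bigcup_N \bigcap_(n >= N)
    covered (cover slope offset base next alive n 0)).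
  split.
  - apply: bigcup_measurable => N _; apply: bigcap_measurableType => n _.
    exact: (@measurable_covered _ _).
  - move=> t [i [x [ix <- SK SM]]]; have [N HN] := SM M.+1.
    exists N => // n Nn /=.
    have -> : 0 = W 0%N i :> R by rewrite /W big_ord0.
    apply: (@covered_cover _ _ _ _ _ _ _ i x (W ^~ i) n 0) => [j|j|j _|].
    + by have [] := ix j.
    + by rewrite /W big_ord_recr.
    + exact: SK.
    + rewrite add0n /base HN// /covered /=.
      by have [+ _ _] := ix n; rewrite ler_norml; lra.
  - apply: measure_liminf_le => n; first exact: (@measurable_covered _ _).
    apply: (le_trans (measure_covered _)); rewrite lee_fin -mulrA ler_wpM2l//.
    have := weight_cover offset ler01 V0 baseV nextV n 0.
    by rewrite expr1n mul1r /V subr0 max_r// addr_ge0.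
have := negligible_bigcup Z0; apply: negligibleS.
move=> t /= /not_implyP[t01 /contrapT tdiff].
have [i [x [ix xt]]] := exists_code (in_unit t01).
have [v fv] := derivable_has_derivative tdiff; rewrite -xt in fv.
have [_ r0] := derivative_eq0 ix fv.
have SE n : expR (W n i) = \prod_(k < n) (lam (i k) / c (i k)).
  elim: n => [|n IH]; first by rewrite /W !big_ord0 expR0.
  rewrite /W !big_ord_recr /= expRD -/(W n i) IH lnK// posrE.
  by rewrite divr_gt0.
have SM (M : nat) : exists N, forall n, (N <= n)%N -> W n i <= - M%:R.
  move/cvgrPdist_le : r0 => /(_ _ (expR_gt0 (- M%:R)))[N _ HN].
  exists N => n /HN; rewrite /= sub0r normrN -SE ger0_norm ?expR_ge0//.
  by rewrite ler_expR.
(* From [N] on the walk is nonpositive; [B] dominates the finitely many earlier values. *)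
have [N HN] := SM 0%N.
pose B := \sum_(k < N) `|W k i|.
have SB n : W n i <= B.
  have B0 : 0 <= B by exact: sumr_ge0.
  have [nN|/HN] := ltnP n N; last by rewrite oppr0 => /le_trans; apply.
  rewrite (le_trans (ler_norm _))// /B (bigD1 (Ordinal nN))//= lerDl.
  exact: sumr_ge0.
exists (Num.bound B) => //; exists i, x; split=> // n.
by rewrite (le_lt_trans (SB n))// archi_boundP// sumr_ge0.
Qed.

(** * Zero derivative on a Cantor set *)

Lemma contraction_near j p e : lam j < c j -> 0 <= p <= 1 -> 0 < e ->
  exists a b L, [/\ scales f a b L, L < `|a| &
    forall y, 0 <= y <= 1 -> `|a * y + b - p| < e].
Proof.
move=> lamj p01 e0; have [i [x [ix xp]]] := exists_code p01.
move/cvgrPdist_lt : (prod_slope_cvg0 i) => /(_ _ e0)[n _ /(_ n (leqnn n))].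
rewrite /= sub0r normrN; have scA := code_scales ix n.
have dist := code_dist _ x; set A := \prod_(k < n) _ in scA * => Ae.
rewrite /= -/A in scA; set L := \prod_(k < n) _ in scA.
have scj k : exists b, scales f (slope j ^+ k) b (lam j ^+ k).
  elim: k => [|k [b sck]]; first by exists 0; rewrite !expr0; exact: scales_id.
  by rewrite !exprSr; eexists; exact: scales_comp sck (phi_scales j).
have [A0 L0 _ _] := scA.
(* The first [n] digits of [p] fix the location; repeating the digit [j] then brings the ratio below
   the slope. *)
have [k kL] : exists k, L * (lam j / c j) ^+ k < `|A|.
  have := @cvg_geometric R L (lam j / c j); rewrite ger0_norm; last first.
    by rewrite divr_ge0 ?lam_ge0 ?ltW.
  rewrite ltr_pdivrMr// mul1r => /(_ lamj) /cvgrPdist_lt/(_ `|A|).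
  rewrite normr_gt0 => /(_ A0)[k _ /(_ k (leqnn k))] /=.
  rewrite sub0r normrN => /(le_lt_trans (ler_norm _)) ?; by exists k.
have [b sck] := scj k; have scAk := scales_comp scA sck.
eexists; eexists; eexists; split; first exact: scAk.
  rewrite normrM normrX norm_slope; move: kL.
  by rewrite expr_div_n mulrA ltr_pdivrMr// exprn_gt0.
move=> y /(let: And4 _ _ H _ := sck in H y) y01.
have -> : forall u, A * slope j ^+ k * y + (A * b + u) - p =
   A * (slope j ^+ k * y + b) + u - p by move=> u; ring.
rewrite -xp code_dist normrM; apply: le_lt_trans Ae.
rewrite ler_piMr//; have [+ _ _] := ix n; move: y01.
by rewrite ler_norml; lra.
Qed.

Lemma uncountable_zero_derivative : (exists i, lam i < c i) ->
  ~ countable [set t : R | 0 < t < 1 /\ zero_derivative_at f t].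
Proof.
(* With radius [1 / 5] about these centers the two images are disjoint and stay [1 / 20] away from 0
   and 1. *)
move=> [j lamj]; pose p (w : bool) : R := if w then 1 / 4 else 3 / 4.
have /choice[a /choice[b /choice[L abL]]] : forall w, exists a b L,
  [/\ scales f a b L, L < `|a| &
    forall y, 0 <= y <= 1 -> `|a * y + b - p w| < 1 / 5].
  by move=> w; apply: (contraction_near lamj); rewrite /p; case: w; lra.
have abp w y : 0 <= y <= 1 -> p w - 1 / 5 < a w * y + b w < p w + 1 / 5.
  by case: (abL w) => _ _ H /H; rewrite ltr_norml; lra.
have ab_mid w y : 0 <= y <= 1 -> 1 / 20 <= a w * y + b w <= 19 / 20.
  by move=> /(abp w); rewrite /p; case: w; lra.
have a0 w : 0 < `|a w| by rewrite normr_gt0; have [[]] := abL w.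
(* The image has length [|a w|] and lies in a ball of radius [1 / 5]. *)
have a1 w : `|a w| <= 2 / 5.
  have [zero01 one01] : 0 <= (0 : R) <= 1 /\ 0 <= (1 : R) <= 1.
    by rewrite !lexx ler01.
  by have := abp w 0 zero01; have := abp w 1 one01; rewrite ler_norml; lra.
have [D D0 fD] := f_bounded.
pose th := Num.max (L true / `|a true|) (L false / `|a false|).
pose am := Num.min `|a true| `|a false|.
have Lth w : L w <= th * `|a w|.
  by rewrite -ler_pdivrMr// le_max; case: w; rewrite lexx ?orbT.
have th0 : 0 <= th.
  by have [[_ L0 _ _] _ _] := abL true; rewrite le_max divr_ge0.
have th1 : th < 1.
  rewrite gt_max !ltr_pdivrMr// !mul1r.
  by have [_ -> _] := abL true; have [_ -> _] := abL false.
have am0 : 0 < am by rewrite lt_min !a0.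
have ama w : am <= `|a w| by rewrite ge_min; case: w; rewrite lexx ?orbT.
apply: (@uncountable_codes _ a b) => [w|w y y01|y z y01 z01|w x x01 xS].
- by rewrite -normr_gt0.
- by have := ab_mid w y y01; lra.
- rewrite lt_eqF//; have := abp true y y01; have := abp false z z01.
  by rewrite /p; lra.
have wx : code f (a \o w) (b \o w) (L \o w) x.
  by move=> n; split=> //; have [] := abL (w n).
have x_mid n : 1 / 20 <= x n <= 19 / 20 by rewrite xS; exact: ab_mid.
split; first by have := x_mid 0%N; lra.
apply: has_derivative_is_derive.
(* The gap comes from [x n.+1] being [1 / 20] away from 0 and 1; the factor [20 / am] compensates
   for it, and [th ^+ n] bounds the ratio of scalings to slopes. *)
apply: (@code_zero_derivative _ _ _ _ _ _ _ wx D
  (fun n => D * (20 / am) * th ^+ n) (fun n => `|a (w n)| / 20) 0 _ fD).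
- by apply: (@prod_cvg0 _ (a \o w) (2 / 5)) => [k|]; [exact: a1|lra].
- move=> n _; rewrite /= {1 2}xS addrK; split; first by rewrite divr_gt0.
    rewrite normrM ler_pM2l//; have := x_mid n.+1 => ?.
    by rewrite ger0_norm; lra.
  have -> : a (w n) * x n.+1 + b (w n) - (a (w n) + b (w n)) =
    a (w n) * (x n.+1 - 1) by ring.
  rewrite normrM ler_pM2l//; have := x_mid n.+1 => ?.
  by rewrite ler0_norm; lra.
- move=> n _.
  have prodL : \prod_(k < n) L (w k) <= th ^+ n * `|\prod_(k < n) a (w k)|.
    rewrite normr_prod -[n in th ^+ n]card_ord -prodr_const -big_split /=.
    apply: ler_prod => k _; rewrite Lth andbT.
    by have [[]] := abL (w k).
  rewrite /= -!mulrA ler_wpM2l//; apply: (le_trans prodL).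
  have -> : 20 * (am^-1 * (th ^+ n * (`|\prod_(k < n) a (w k)| *
      (`|a (w n)| / 20)))) =
    th ^+ n * `|\prod_(k < n) a (w k)| * (`|a (w n)| / am).
    by field; rewrite gt_eqF.
  by rewrite ler_peMr ?mulr_ge0 ?exprn_ge0// ler_pdivlMr// mul1r.
- rewrite -[0](mulr0 (D * (20 / am))); apply: cvgM; first exact: cvg_cst.
  by apply: cvg_expr; rewrite ger0_norm.
Qed.

End SelfAffine.

Theorem theorem2p2 (R : realType) (d m : nat) (hd : (1 <= d)%N)
    (hm : (2 <= m)%N)
    (eps : 'I_m -> bool) (S : 'I_m -> 'rV[R]_d -> 'rV[R]_d)
    (lam c : 'I_m -> R) (f : R -> 'rV[R]_d)
    (hS : forall i, contractive_similitude (S i) (lam i))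
    (hlam : m = 2%N -> forall i, 0 < lam i)
    (hfirst : forall i : 'I_m, (i : nat) = 0%N ->
       S i (start_pt R d (eps i)) = pt_a R d)
    (hlast : forall i : 'I_m, i.+1 = m ->
       S i (end_pt R d (eps i)) = pt_b R d)
    (hchain : forall i j : 'I_m, (j : nat) = i.+1 ->
       S i (end_pt R d (eps i)) = S j (start_pt R d (eps j)))
    (hc : forall i, 0 < c i)
    (hc1 : \sum_(i < m) c i = 1)
    (hlamc : lam <> c)
    (hfcont : {within `[0, 1], continuous f})
    (hf : forall (i : 'I_m) (t : R), piece eps c i t ->
       f t = S i (f (phi_inv eps c i t))) :
  ((forall i, c i <= lam i) ->
     forall t : R, 0 < t < 1 -> ~ differentiable_at f t)
  /\
  ((exists i, lam i < c i) -> (0 <= mean_log_ratio lam c)%E ->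
     {ae lebesgue_measure, forall t : R,
        0 < t < 1 -> ~ differentiable_at f t} /\
     ~ countable [set t : R | 0 < t < 1 /\ zero_derivative_at f t])
  /\
  ((mean_log_ratio lam c < 0)%E ->
     {ae lebesgue_measure, forall t : R,
        0 < t < 1 -> zero_derivative_at f t} /\
     ~ countable [set t : R | 0 < t < 1 /\ ~ differentiable_at f t]).
Proof.
split; [|split].
- exact: (nowhere_differentiable hd hm hS hfirst hlast hc hc1 hlamc hf).
- move=> lamc mean0; split.
    exact: (ae_nondifferentiable hd hm hS hfirst hlast hc hc1 hlamc hf mean0).
  exact: (uncountable_zero_derivative hm hS hc hc1 hfcont hf lamc).
- move=> mean0; split.
    exact: (ae_zero_derivative hm hS hc hc1 hfcont hf mean0).
  exact: (uncountable_nondifferentiable hd hm hS hfirst hlast hc hc1 hlamc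
    hfcont hf).
Qed.
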